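(* Let $m$ be an odd positive integer, $t=2^{(m+1)/2}$, and $\delta\in\mathbb{F}_{2^{2m}}$. Then $$f(x)=x+\left(\mathrm{Tr}_m^{2m}(x)^{t-1}+\delta\right)^{t+1}$$ is a permutation polynomial of $\mathbb{F}_{2^{2m}}$ and its compositional inverse over $\mathbb{F}_{2^{2m}}$ is $$f^{-1}(x)=x+\left(\left(\mathrm{Tr}_m^{2m}(x)+\delta^{2^{(m+1)/2}+2^m}+\delta^{2^{(3m+1)/2}+1}\right)^{t-1}+\delta^{2^m}\right)^{t+1}.$$
   Context: $\mathrm{Tr}_m^{2m}(x)=x+x^{2^m}$ is the trace map from $\mathbb{F}_{2^{2m}}$ to $\mathbb{F}_{2^m}$. The compositional inverse of a permutation polynomial $F$ of a finite field $\mathbb{F}$ is the unique polynomial map $F^{-1}$ with $F(F^{-1}(x))=F^{-1}(F(x))=x$ for all $x\in\mathbb{F}$. *)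

(* Defs.v *)
From HB Require Import structures.
From mathcomp Require Import all_boot all_order all_algebra all_field.

Set Implicit Arguments.
Unset Strict Implicit.
Unset Printing Implicit Defensive.

Import GRing.Theory.
Local Open Scope ring_scope.

(* The trace x + x^(2^m) from GF(2^(2m)) to GF(2^m).  It is stated over any
   ring so that it also applies to the indeterminate 'X of {poly F}. *)
Definition Tr (R : nzRingType) (m : nat) (x : R) : R := x + x ^+ (2 ^ m).

Definition permutation_polynomial (F : finFieldType) (p : {poly F}) : Prop :=
  bijective (fun x : F => p.[x]).

(* Only the polynomial map of the inverse is determined: polynomials that agree
   modulo 'X^#|F| - 'X are not distinguished. *)
Definition compositional_inverse (F : finFieldType) (p q : {poly F}) : Prop :=
  forall x : F, p.[q.[x]] = x /\ q.[p.[x]] = x.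

(* Main.v *)
(** Let [q = 2 ^ m], [T = Tr x] and [a = T^(t-1)].  Since [t^2 = 2q], we have
    [y^(t^2-1) = y] on GF(q), so [y |-> y^(t-1)] and [y |-> y^(t+1)] are inverse
    permutations of GF(q); in particular [T = a^(t+1)].  Expanding
    [(a + delta)^(t+1)] and taking traces, the additive constant in the inverse is
    exactly what completes [Tr (f x)] to [(a + Tr delta)^(t+1)].  Raising this to
    the power [t-1] returns [a + Tr delta], and adding [delta^q] gives back
    [a + delta], so the inverse subtracts from [f x] what [f] added to [x]. *)

Require Import Defs.
From HB Require Import structures.
From mathcomp Require Import all_boot all_order all_algebra all_field.
From mathcomp Require Import ring zify.

Set Implicit Arguments.
Unset Strict Implicit.
Unset Printing Implicit Defensive.

Import GRing.Theory.
Local Open Scope ring_scope.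

(** For nonzero [y], cancel one factor from [y ^+ (2 * q) = y ^+ 2]. When [t ^ 2 = 2 * q], this
    makes the powers [t - 1] and [t + 1] mutually inverse on such [y]. *)
Lemma expr_double_pred (F : fieldType) (q : nat) (y : F) :
  (0 < q)%N -> y ^+ q = y -> y ^+ (2 * q - 1) = y.
Proof.
move=> q0 yq; have [->|y0] := eqVneq y 0.
  by case: q q0 {yq} => // q _; rewrite mul2n doubleS subn1 expr0n.
apply: (mulIf y0).
by rewrite -exprSr -subSn ?muln_gt0 ?q0 // subn1 mulnC exprM yq expr2.
Qed.

Lemma exprD2n (R : comNzRingType) (n : nat) (x y : R) :
  2 \in [pchar R] -> (x + y) ^+ (2 ^ n) = x ^+ (2 ^ n) + y ^+ (2 ^ n).
Proof.
move=> ch2; apply: exprDn_pchar.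
by rewrite pnatX (pnatE _ (pcharf_prime ch2)) ch2.
Qed.

Lemma horner_Tr (R : comNzRingType) (m : nat) (x : R) :
  (Tr m 'X).[x] = Tr m x.
Proof. by rewrite /Tr hornerD hornerX hornerXn. Qed.

Lemma Tr_fixed (R : comNzRingType) (m : nat) (x : R) :
  2 \in [pchar R] -> x ^+ (2 ^ (2 * m)) = x ->
  (Tr m x) ^+ (2 ^ m) = Tr m x.
Proof.
by move=> ch2 xm; rewrite /Tr exprD2n // -exprM -expnD addnn -mul2n xm addrC.
Qed.

Lemma TrD (R : comNzRingType) (m : nat) (x y : R) :
  2 \in [pchar R] -> Tr m (x + y) = Tr m x + Tr m y.
Proof. by move=> ch2; rewrite /Tr exprD2n // addrACA. Qed.

(** With [b = delta ^+ (2 ^ m)], the two added terms are the cross products of [delta] and [b] that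
    the trace lacks. *)
Lemma Tr_shifted_power (R : comNzRingType) (m n : nat) (a delta : R) :
  2 \in [pchar R] -> a ^+ (2 ^ m) = a ->
  Tr m ((a + delta) ^+ (2 ^ n + 1)) + delta ^+ (2 ^ n + 2 ^ m)
    + delta ^+ (2 ^ (m + n) + 1)
  = a ^+ (2 ^ n + 1) + (a + Tr m delta) ^+ (2 ^ n + 1).
Proof.
move=> ch2 aq; rewrite /Tr -[in LHS]exprM [((2 ^ n + 1) * _)%N]mulnC exprM.
rewrite exprD2n // aq !exprD !expr1 !exprD2n // expnD exprM.
set A := a ^+ _; set b := delta ^+ (2 ^ m).
set D := delta ^+ _; set B := b ^+ _.
rewrite -/b; ring.
Qed.

Lemma inverse_cancel (m k : nat) (F : finFieldType) (delta x : F) :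
  m = k.*2.+1 -> #|F| = (2 ^ (2 * m))%N ->
  let t := (2 ^ k.+1)%N in
  let y := x + (Tr m x ^+ (t - 1) + delta) ^+ (t + 1) in
  y + ((Tr m y + delta ^+ (t + 2 ^ m) + delta ^+ (2 ^ (m + k.+1) + 1)) ^+ (t - 1)
       + delta ^+ (2 ^ m)) ^+ (t + 1) = x.
Proof.
move=> mE hF t y.
have ch2 : 2 \in [pchar F] by apply: card_finPcharP hF _.
have fixF (z : F) : z ^+ (2 ^ (2 * m)) = z by rewrite -hF expf_card.
have Tq (z : F) : (Tr m z) ^+ (2 ^ m) = Tr m z by apply: Tr_fixed.
have char2 (z : F) : z + z = 0 by exact: addrr_pchar2.
(* Oddness of [m] enters here: [t ^ 2 = 2 ^ (2 * k + 2) = 2 * 2 ^ m]. *)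
have tE : ((t - 1) * (t + 1) = 2 * 2 ^ m - 1)%N.
  rewrite mulnC -[X in (_ - X)%N]/(1 ^ 2)%N -expnS mE.
  by rewrite mulnC -subn_sqr /t -expnM muln2 doubleS.
pose a := Tr m x ^+ (t - 1).
have aq : a ^+ (2 ^ m) = a by rewrite /a exprAC Tq.
have aT : a ^+ (t + 1) = Tr m x.
  by rewrite -exprM tE expr_double_pred ?expn_gt0.
have -> : Tr m y + delta ^+ (t + 2 ^ m) + delta ^+ (2 ^ (m + k.+1) + 1)
     = (a + Tr m delta) ^+ (t + 1).
  (* The summand [Tr m x] of [Tr m y] equals [a ^+ (t + 1)] and cancels the extra term of the
     expansion. *)
  rewrite TrD // -/a -2!addrA [X in _ + X]addrA Tr_shifted_power //.
  by rewrite aT addrA char2 add0r.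
have aDq : (a + Tr m delta) ^+ (2 ^ m) = a + Tr m delta.
  by rewrite exprD2n // aq Tq.
rewrite -exprM mulnC tE expr_double_pred ?expn_gt0 //.
(* First the two copies of [delta ^+ (2 ^ m)] cancel, then those of [(a + delta) ^+ (t + 1)]. *)
by rewrite /Tr -!addrA char2 addr0 char2 addr0.
Qed.

Theorem theorem9 (m : nat) (hm0 : (0 < m)%N) (hm : odd m)
    (F : finFieldType) (hF : #|F| = (2 ^ (2 * m))%N) (delta : F) :
  let t := (2 ^ ((m + 1) %/ 2))%N in
  let f : {poly F} :=
    'X + (Tr m 'X ^+ (t - 1) + delta%:P) ^+ (t + 1) in
  let g : {poly F} :=
    'X + ((Tr m 'X
           + (delta ^+ (2 ^ ((m + 1) %/ 2) + 2 ^ m))%:P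
           + (delta ^+ (2 ^ ((3 * m + 1) %/ 2) + 1))%:P) ^+ (t - 1)
          + (delta ^+ (2 ^ m))%:P) ^+ (t + 1) in
  permutation_polynomial f /\ compositional_inverse f g.
Proof.
move=> t f g.
have mE : m = m./2.*2.+1 by rewrite -[LHS]odd_double_half hm.
have e1 : ((m + 1) %/ 2 = m./2.+1)%N by lia.
have e2 : ((3 * m + 1) %/ 2 = m + m./2.+1)%N by lia.
have fK : cancel (fun x => f.[x]) (fun x => g.[x]).
  move=> x; rewrite /f /g /t e1 e2.
  rewrite !(horner_exp, hornerD, hornerX, hornerC, horner_Tr).
  exact: inverse_cancel.
(* On the finite set [F] a left inverse is also a right inverse. *)
have gK := canF_sym fK.
split; first exact: Bijective fK gK.
by move=> x; split; [exact: gK | exact: fK].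
Qed.
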